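(* Let $A\in\mathbb{R}^{n\times n}$ be symmetric positive definite, $b\in\mathbb{R}^n$, $f(x)=\frac12\langle x,Ax\rangle-\langle b,x\rangle$, and suppose $f$ is $L$-smooth. Let $K\ge1$, $x^1\in\mathbb{R}^n$, $P_1\in\mathbb{R}^{n\times n}$, and let $\{x^k\}$ be generated by OSGM-R with $\mathcal{P}=\mathbb{R}^{n\times n}$ and stepsize $\eta=\frac1{4L^2}$. Assume $x^1,\dots,x^K$ are not the minimizer $x^\star$ of $f$. Then $$f(x^{K+1})-f(x^\star)\le(f(x^1)-f(x^\star))\Big(\frac{4L^2\|P_1-A^{-1}\|_F^2}{K}\Big)^K.$$
   Context: $\|\cdot\|_F$ is the Frobenius norm. $f$ is $L$-smooth if $|f(x)-f(y)-\langle\nabla f(y),x-y\rangle|\le\frac L2\|x-y\|^2$ for all $x,y$. Ratio surrogate: for $x\ne x^\star$ and $P\in\mathbb{R}^{n\times n}$, $r_x(P):=\dfrac{f(x-P\nabla f(x))-f(x^\star)}{f(x)-f(x^\star)}$, with gradient in $P$: $\nabla r_x(P)=-\dfrac{\nabla f(x-P\nabla f(x))\nabla f(x)^\top}{f(x)-f(x^\star)}$. OSGM-R with $\mathcal{P}=\mathbb{R}^{n\times n}$: for $k=1,2,\dots$: $x^{k+1}=x^k-P_k\nabla f(x^k)$ and $P_{k+1}=P_k-\eta\nabla r_{x^k}(P_k)$ (no projection is needed). *)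

(* Defs.v *)
From HB Require Import structures.
From mathcomp Require Import all_boot all_order all_algebra.
From mathcomp Require Import all_classical all_reals all_analysis.
Set Implicit Arguments.
Unset Strict Implicit.
Unset Printing Implicit Defensive.
Import Order.TTheory GRing.Theory Num.Theory.
Import numFieldNormedType.Exports.
Local Open Scope ring_scope.

Section Defs.
Variable R : realType.

(* The library norm `|_| on matrices is the sup norm, hence the explicit
   Euclidean and Frobenius norms below. *)

Definition dot n (u v : 'cV[R]_n) : R := \sum_(i < n) u i 0 * v i 0.

Definition enorm n (u : 'cV[R]_n) : R := Num.sqrt (dot u u).

Definition frobnorm m n (M : 'M[R]_(m, n)) : R :=
  Num.sqrt (\sum_(i < m) \sum_(j < n) M i j ^+ 2).

Definition posdefmx n (A : 'M[R]_n) : Prop :=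
  A^T = A /\ forall x : 'cV[R]_n, x != 0 -> 0 < dot x (A *m x).

(* Matrix of partial derivatives; for functions of a vector take n = 1. *)
Definition grad m n (g : 'M[R]_(m, n) -> R) (X : 'M[R]_(m, n)) :
    'M[R]_(m, n) :=
  \matrix_(i, j) 'D_(delta_mx i j) (g : 'M[R]_(m, n) -> R^o) X.

Definition lsmooth n (L : R) (f : 'cV[R]_n -> R) : Prop :=
  forall x y : 'cV[R]_n,
    `|f x - f y - dot (grad f y) (x - y)| <= L / 2 * enorm (x - y) ^+ 2.

Definition minimizer n (f : 'cV[R]_n -> R) (xs : 'cV[R]_n) : Prop :=
  forall y : 'cV[R]_n, f xs <= f y.

Definition quadratic n (A : 'M[R]_n) (b x : 'cV[R]_n) : R :=
  2^-1 * dot x (A *m x) - dot b x.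

Definition ratio n (f : 'cV[R]_n -> R) (xs x : 'cV[R]_n) (P : 'M[R]_n) : R :=
  (f (x - P *m grad f x) - f xs) / (f x - f xs).

(* First K steps, indexed from 1 (x 0 and P 0 are irrelevant).  The steps are
   only required up to K because [ratio] divides by f (x k) - f xs. *)
Definition osgm_r n (f : 'cV[R]_n -> R) (xs : 'cV[R]_n) (eta : R) (K : nat)
    (x : nat -> 'cV[R]_n) (P : nat -> 'M[R]_n) : Prop :=
  forall k : nat, (1 <= k <= K)%N ->
    x k.+1 = x k - P k *m grad f (x k) /\
    P k.+1 = P k - eta *: grad (ratio f xs (x k)) (P k).

End Defs.

(* Main.v *)
(** For the ratio surrogate [r] at [x^k], [r] is a quadratic in [P] minimized at
    [A^-1] with value [0], so [<grad r (P), P - A^-1> = 2 r (P)]; and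
    [|A v|^2 <= L <v, A v>] gives [|grad r (P)|_F^2 <= 4 L^2 r (P)].  With step
    [1 / (4 L^2)] the squared distance of [P_k] to [A^-1] thus drops by at least
    [r_k / (4 L^2)] at each step, so the ratios [r_k] sum to at most
    [4 L^2 |P_1 - A^-1|_F^2].  Their product is the total decrease of the gap,
    which AM-GM bounds. *)
Require Import Defs.
From mathcomp Require Import all_boot all_order all_algebra.
From mathcomp Require Import all_classical all_reals all_analysis.
From mathcomp Require Import ring lra.
Set Implicit Arguments.
Unset Strict Implicit.
Unset Printing Implicit Defensive.
Import Order.TTheory GRing.Theory Num.Theory.
Import numFieldNormedType.Exports.
Local Open Scope ring_scope.

(** * Algebra of the Euclidean inner product *)

Section Dot.
Context {R : realType} {n : nat}.
Implicit Types (u v w : 'cV[R]_n) (c : R).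

Lemma dotC u v : dot u v = dot v u.
Proof. by apply: eq_bigr => i _; rewrite mulrC. Qed.

Lemma dotDl u v w : dot (u + v) w = dot u w + dot v w.
Proof. by rewrite /dot -big_split; apply: eq_bigr => i _; rewrite mxE mulrDl. Qed.

Lemma dotZl c u v : dot (c *: u) v = c * dot u v.
Proof. by rewrite /dot mulr_sumr; apply: eq_bigr => i _; rewrite mxE mulrA. Qed.

Lemma dotDr u v w : dot u (v + w) = dot u v + dot u w.
Proof. by rewrite dotC dotDl !(dotC u). Qed.

Lemma dotZr c u v : dot u (c *: v) = c * dot u v.
Proof. by rewrite dotC dotZl dotC. Qed.

Lemma dotNl u v : dot (- u) v = - dot u v.
Proof. by rewrite -scaleN1r dotZl mulN1r. Qed.

Lemma dotNr u v : dot u (- v) = - dot u v.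
Proof. by rewrite dotC dotNl dotC. Qed.

Lemma dot_delta i u : dot (delta_mx i 0) u = u i 0.
Proof.
rewrite /dot (bigD1 i) //= mxE !eqxx mul1r big1 ?addr0 // => j ji.
by rewrite mxE (negbTE ji) mul0r.
Qed.

Lemma mul_delta_mx_col m (i : 'I_m) (j : 'I_n) u :
  delta_mx i j *m u = u j 0 *: delta_mx i 0.
Proof.
apply/matrixP => k l; rewrite (ord1 l) !mxE (bigD1 j) //= big1.
  by rewrite mxE !eqxx !andbT addr0 mulrC.
by move=> p pj; rewrite mxE (negbTE pj) andbF mul0r.
Qed.

Lemma dotE u v : dot u v = (u^T *m v) 0 0.
Proof. by rewrite mxE; apply: eq_bigr => i _; rewrite mxE. Qed.

Lemma dot_mulmxr (M : 'M[R]_n) u v : dot u (M *m v) = dot v (M^T *m u).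
Proof. by rewrite dotC !dotE trmx_mul mulmxA. Qed.

Lemma dot_ge0 u : 0 <= dot u u.
Proof. by apply: sumr_ge0 => i _; rewrite -expr2 sqr_ge0. Qed.

Lemma enorm_sqr u : enorm u ^+ 2 = dot u u.
Proof. by rewrite sqr_sqrtr // dot_ge0. Qed.

End Dot.

(** * Frobenius norm and rank-one updates *)

Lemma frobnorm_sqr (R : realType) m n (M : 'M[R]_(m, n)) :
  frobnorm M ^+ 2 = \sum_(i < m) \sum_(j < n) M i j ^+ 2.
Proof.
by rewrite sqr_sqrtr //; do 2!(apply: sumr_ge0 => ? _); rewrite sqr_ge0.
Qed.

(** The gradient of the ratio in [P] is an outer product, so this computes exactly how one step
    changes the squared distance to [invmx A]. *)
Lemma frobnorm_sqrD_outer (R : realType) m n (M : 'M[R]_(m, n)) c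
    (u : 'cV[R]_m) (v : 'cV[R]_n) :
  frobnorm (M + c *: (u *m v^T)) ^+ 2 =
  frobnorm M ^+ 2 + 2 * c * dot u (M *m v) + c ^+ 2 * dot u u * dot v v.
Proof.
rewrite !frobnorm_sqr -mulrA [dot u (_ *m _)]/dot [dot u u]/dot.
rewrite -(mulrA (c ^+ 2)) mulr_suml !mulr_sumr -!big_split /=.
apply: eq_bigr => i _; rewrite mxE /dot !mulr_sumr -!big_split /=.
by apply: eq_bigr => j _; rewrite !mxE big_ord1 !mxE; ring.
Qed.

(** * Gradients read off from exact second-order expansions *)

Lemma derive_quadratic_expansion (R : realType) m n
    (g : 'M[R]_(m, n) -> R) (X V : 'M[R]_(m, n)) (a c : R) :
  (forall h, g (h *: V + X) = g X + h * a + h ^+ 2 * c) ->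
  'D_V (g : 'M[R]_(m, n) -> R^o) X = a.
Proof.
move=> gE; rewrite /derive; apply: cvg_lim => //.
have lin : ((fun h : R => a + h * c) @ (0 : R)^' --> a + 0 * c)%classic.
  apply: cvg_within_filter.
  by apply: cvgD; [exact: cvg_cst|apply: cvgM; [exact: cvg_id|exact: cvg_cst]].
rewrite mul0r addr0 in lin.
(* For [h != 0] the difference quotient is exactly [a + h * c]. *)
apply: cvg_trans lin; apply: near_eq_cvg; near=> h.
have h0 : h != 0 by near: h; exact: nbhs_dnbhs_neq.
rewrite /= gE /GRing.scale /=; field; exact: h0.
Unshelve. all: by end_near.
Qed.

Lemma grad_quadratic_expansion (R : realType) m n
    (g : 'M[R]_(m, n) -> R) (X G : 'M[R]_(m, n))
    (C : 'I_m -> 'I_n -> R) :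
  (forall i j h,
     g (h *: delta_mx i j + X) =
     g X + h * G i j + h ^+ 2 * C i j) ->
  grad g X = G.
Proof.
move=> gE; apply/matrixP => i j; rewrite mxE.
exact: (derive_quadratic_expansion (gE i j)).
Qed.

(** * Positive definite quadratics and their ratio surrogate *)

Section Quadratic.
Context {R : realType} {n : nat}.
Variables (A : 'M[R]_n) (b : 'cV[R]_n).
Hypothesis Apos : posdefmx A.
Local Notation f := (quadratic A b).

Lemma dot_symmx u v : dot u (A *m v) = dot v (A *m u).
Proof. by rewrite dot_mulmxr (proj1 Apos). Qed.

Lemma quadraticD v y :
  f (v + y) = f y + dot v (A *m y - b) + 2^-1 * dot v (A *m v).
Proof.
rewrite /quadratic mulmxDr !(dotDl, dotDr, dotNr).
by rewrite (dot_symmx y v) (dotC b v); field.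
Qed.

Lemma grad_quadratic y : grad f y = A *m y - b.
Proof.
apply: (@grad_quadratic_expansion _ _ _ _ _ _
  (fun i j => 2^-1 * dot (delta_mx i j) (A *m delta_mx i j))).
move=> i j h; rewrite quadraticD dotZl -scalemxAr dotZl dotZr (ord1 j).
by rewrite dot_delta; ring.
Qed.

Lemma quadratic_gap xs y : A *m xs = b ->
  f y - f xs = 2^-1 * dot (y - xs) (A *m (y - xs)).
Proof.
move=> Axs; rewrite -{1}[y](subrK xs) quadraticD Axs subrr.
by rewrite -(scale0r (0 : 'cV_n)) dotZr; ring.
Qed.

Lemma posdefmx_dot_ge0 v : 0 <= dot v (A *m v).
Proof.
have [->|v0] := eqVneq v 0; first by rewrite mulmx0 dot_ge0.
exact/ltW/(proj2 Apos).
Qed.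

Lemma posdefmx_unit : A \in unitmx.
Proof.
rewrite unitmxE unitfE; apply/det0P => -[v v0 vA0].
have vT0 : v^T != 0 by apply: contra_neq v0 => vT0; rewrite -[v]trmxK vT0 trmx0.
have := proj2 Apos _ vT0.
by rewrite dotE trmxK mulmxA vA0 mul0mx mxE ltxx.
Qed.

(** Compare [xs] with the stationary point [y], the solution of [A *m y = b]: the gap between their
    values is half the form at [xs - y], which is positive unless they coincide. *)
Lemma minimizer_quadratic xs : minimizer f xs -> A *m xs = b.
Proof.
move=> xsmin; pose y := invmx A *m b.
have Ay : A *m y = b by rewrite mulKVmx // posdefmx_unit.
have gap := quadratic_gap xs Ay.
have [/eqP|/(proj2 Apos)] := eqVneq (xs - y) 0.
  by rewrite subr_eq0 => /eqP ->.
by move=> gap_gt0; exfalso; have := xsmin y; move: gap gap_gt0; lra.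
Qed.

(** Moving the entry [(i, j)] of [Q] by [h] shifts the trial point by [- (h * g j 0)] along the
    [i]-th basis vector, so the expansion of [f] there is also one of the ratio in [h]. *)
Lemma grad_ratio xs y Q : let g := grad f y in
  grad (Defs.ratio f xs y) Q =
  - (f y - f xs)^-1 *: (grad f (y - Q *m g) *m g^T).
Proof.
move=> g.
apply: (@grad_quadratic_expansion _ _ _ _ _ _
  (fun i j => (f y - f xs)^-1 * 2^-1 * g j 0 ^+ 2
     * dot (delta_mx i 0) (A *m delta_mx i 0))).
move=> i j h; rewrite /Defs.ratio -/g; clearbody g.
have -> : y - (h *: delta_mx i j + Q) *m g =
    (- (h * g j 0)) *: delta_mx i 0 + (y - Q *m g).
  suff -> : (h *: delta_mx i j + Q) *m g =
      (h * g j 0) *: delta_mx i 0 + Q *m g.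
    by rewrite scaleNr opprD addrCA.
  by rewrite mulmxDl -scalemxAl mul_delta_mx_col scalerA.
rewrite (quadraticD (_ *: _)) -scalemxAr !dotZl dotZr -grad_quadratic.
move: (grad f _) => g'; rewrite (dot_delta _ g') !mxE big_ord1 [g^T _ _]mxE.
by ring.
Qed.

(** * Consequences of smoothness and the one-step decrease *)

Variable L : R.
Hypothesis fsmooth : lsmooth L f.

(** The linearization error of [f] at 0 is exactly half the form at [v]. *)
Lemma lsmooth_quadratic v : dot v (A *m v) <= L * dot v v.
Proof.
have := fsmooth v 0; rewrite grad_quadratic -{1}[v]addr0 quadraticD.
rewrite subr0 enorm_sqr mulmx0 sub0r.
by rewrite ler_norml => /andP[_]; rewrite (dotC v (- b)); lra.
Qed.

(** A nonzero vector is required: in dimension 0 every [L] satisfies [lsmooth]. *)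
Lemma lsmooth_gt0 (v : 'cV[R]_n) : v != 0 -> 0 < L.
Proof.
move=> /(proj2 Apos) v0; have := lt_le_trans v0 (lsmooth_quadratic v).
by have := dot_ge0 v; nra.
Qed.

Lemma lsmooth_grad_le v : dot (A *m v) (A *m v) <= L * dot v (A *m v).
Proof.
have [->|v0] := eqVneq v 0.
  by rewrite !mulmx0 -(scale0r (0 : 'cV_n)) !dotZl !mul0r mulr0.
have L0 := lsmooth_gt0 v0.
(* Nonnegativity of the form at the gradient step [v - L^-1 A v]. *)
have := posdefmx_dot_ge0 (v - L^-1 *: (A *m v)).
rewrite mulmxBr -scalemxAr !(dotDl, dotDr, dotNl, dotNr, dotZl, dotZr).
rewrite (dot_symmx v (A *m v)).
have := lsmooth_quadratic (A *m v).
set s := dot (A *m v) (A *m v); set q := dot v _; set w := dot _ _ => ws ge0.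
(* Scaled by [L ^+ 2], the form is [L ^+ 2 * q - 2 * L * s + w], and [w <= L * s] by smoothness at
   [A *m v]. *)
rewrite -(ler_pM2l L0) -subr_ge0; apply: le_trans (mulr_ge0 (sqr_ge0 L) ge0) _.
rewrite [leLHS](_ : _ = L ^+ 2 * q - 2 * L * s + w); first by lra.
by field; rewrite gt_eqF.
Qed.

Lemma osgm_r_step xs y y' Q Q' : A *m xs = b -> y <> xs ->
  y' = y - Q *m grad f y ->
  Q' = Q - (1 / (4 * L ^+ 2)) *: grad (Defs.ratio f xs y) Q ->
  4 * L ^+ 2 * frobnorm (Q' - invmx A) ^+ 2 + (f y' - f xs) / (f y - f xs) <=
  4 * L ^+ 2 * frobnorm (Q - invmx A) ^+ 2.
Proof.
move=> Axs /eqP; rewrite -subr_eq0 => e0 y'E Q'E.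
have L0 := lsmooth_gt0 e0.
have phi0 := proj2 Apos _ e0.
have gradE z : grad f z = A *m (z - xs) by rewrite grad_quadratic mulmxBr Axs.
(* With [invmx A] in place of [Q] the step is Newton's and lands on [xs]; hence the cross term of
   the expansion is a multiple of the gap at [y']. *)
have e'E : (Q - invmx A) *m (A *m (y - xs)) = - (y' - xs).
  by rewrite y'E gradE mulmxBl (mulKmx posdefmx_unit) [in RHS]addrAC [RHS]opprB.
rewrite Q'E grad_ratio -y'E !gradE scalerA mulrN scaleNr opprK addrAC.
rewrite frobnorm_sqrD_outer e'E dotNr dotC !(quadratic_gap _ Axs).
have q'0 := posdefmx_dot_ge0 (y' - xs).
have gg' := lsmooth_grad_le (y' - xs).
have gg := lsmooth_grad_le (y - xs).
have s'0 := dot_ge0 (A *m (y' - xs)).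
have s0 := dot_ge0 (A *m (y - xs)).
move: phi0 q'0 gg' gg s'0 s0.
set q := dot (y - xs) _; set q' := dot (y' - xs) _.
set s' := dot (A *m (y' - xs)) _; set s := dot _ _.
move=> q0 q'0 gg' gg s'0 s0.
have ss : s' * s <= L ^+ 2 * (q' * q).
  have -> : L ^+ 2 * (q' * q) = (L * q') * (L * q) by ring.
  exact: ler_pM.
have qn0 : q != 0 by rewrite gt_eqF.
have Ln0 : L != 0 by rewrite gt_eqF.
rewrite -subr_ge0.
set d := _ - _.
(* The cross term yields a decrease of [4 * q' / q]. The claim uses one [q' / q], which leaves the
   factor 3, and by [ss] the second-order term costs at most one more. *)
suff -> : d = (3 * L ^+ 2 * (q' * q) - s' * s) / (L ^+ 2 * q ^+ 2).
  apply: divr_ge0; last by rewrite mulr_ge0 ?sqr_ge0.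
  have : 0 <= L ^+ 2 * (q' * q) by rewrite mulr_ge0 ?sqr_ge0 // mulr_ge0 // ltW.
  by lra.
by rewrite /d; field; rewrite qn0 Ln0.
Qed.

End Quadratic.

(** * From the sum of the ratios to their product *)

Lemma prod_ratio_le_mean (R : realFieldType) (K : nat) (phi : nat -> R) (c : R) :
  (forall k, (k < K)%N -> 0 < phi k) -> 0 <= phi K ->
  \sum_(k < K) phi k.+1 / phi k <= c ->
  phi K <= phi 0%N * (c / K%:R) ^+ K.
Proof.
move=> phi_gt0 phiK sum_le.
have phi_ge0 k : (k <= K)%N -> 0 <= phi k.
  by rewrite leq_eqVlt => /orP[/eqP ->|/phi_gt0/ltW].
have r_ge0 (k : 'I_K) : 0 <= phi k.+1 / phi k.
  by rewrite divr_ge0 // phi_ge0 // ltnW.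
(* The product telescopes. Only [phi 0], ..., [phi K.-1] occur as divisors, so [phi K] may vanish:
   the last iterate may be the minimizer. *)
have -> : phi K = phi 0%N * \prod_(k < K) (phi k.+1 / phi k).
  elim: K phi_gt0 {phiK sum_le phi_ge0 r_ge0} => [_|K IH phi_gt0].
    by rewrite big_ord0 mulr1.
  rewrite big_ord_recr /= mulrA -IH; last by move=> k /ltnW; exact: phi_gt0.
  by rewrite mulrCA divff ?mulr1 // gt_eqF // phi_gt0.
apply: ler_wpM2l; first exact: phi_ge0.
have [] := @leif_AGM R _ predT (fun k : 'I_K => phi k.+1 / phi k).
  by move=> k _; exact: r_ge0.
rewrite cardT size_enum_ord => /le_trans + _; apply.
apply: lerXn2r; rewrite ?nnegrE ?ler_wpM2r ?invr_ge0 ?ler0n //.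
  by rewrite divr_ge0 ?ler0n // sumr_ge0.
by rewrite divr_ge0 ?ler0n // (le_trans _ sum_le) // sumr_ge0.
Qed.

Theorem theorem4p4 (R : realType) (n : nat) (A : 'M[R]_n) (b : 'cV[R]_n)
    (L : R) (K : nat) (xs : 'cV[R]_n)
    (x : nat -> 'cV[R]_n) (P : nat -> 'M[R]_n) :
  posdefmx A ->
  lsmooth L (quadratic A b) ->
  (1 <= K)%N ->
  minimizer (quadratic A b) xs ->
  osgm_r (quadratic A b) xs (1 / (4 * L ^+ 2)) K x P ->
  (forall k : nat, (1 <= k <= K)%N -> x k <> xs) ->
  quadratic A b (x K.+1) - quadratic A b xs <=
    (quadratic A b (x 1%N) - quadratic A b xs) *
    (4 * L ^+ 2 * frobnorm (P 1%N - invmx A) ^+ 2 / K%:R) ^+ K.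
Proof.
move=> Apos fsmooth _ xsmin osgm xneq.
have Axs := minimizer_quadratic Apos xsmin.
(* Shifted by one, since the iterates are numbered from 1. *)
pose phi k := quadratic A b (x k.+1) - quadratic A b xs.
apply: (@prod_ratio_le_mean _ K phi).
- move=> k kK; rewrite /phi (quadratic_gap Apos _ Axs) mulr_gt0 ?invr_gt0 //.
  apply: (proj2 Apos); rewrite subr_eq0; apply/eqP; exact: xneq.
- by rewrite /phi subr_ge0.
pose D k := 4 * L ^+ 2 * frobnorm (P k.+1 - invmx A) ^+ 2.
have D_ge0 k : 0 <= D k by rewrite /D -mulrA mulr_ge0 // mulr_ge0 // sqr_ge0.
(* Keeping the final distance [D K] lets the induction on [K] telescope; its nonnegativity then
   gives the bound on the sum. *)
suff : D K + \sum_(k < K) phi k.+1 / phi k <= D 0%N.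
  by apply: le_trans; rewrite lerDr.
have : forall k, (k < K)%N -> D k.+1 + phi k.+1 / phi k <= D k.
  move=> k kK; have [xE PE] := osgm k.+1 kK.
  exact: (osgm_r_step Apos fsmooth Axs (xneq k.+1 kK) xE PE).
elim: K {osgm xneq} => [_|K IH step]; first by rewrite big_ord0 addr0.
rewrite big_ord_recr /=.
have := IH (fun k kK => step k (ltnW kK)); have := step K (ltnSn K); lra.
Qed.
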